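(* Let $\mathcal{A}$ be a Boolean algebra which is an almost $P$-algebra, and let $K=K_{\mathcal A}$ be its Stone space. Suppose that for every pairwise disjoint family $a = \{a_n: n <\omega\}\subset \mathcal{A}\setminus\{0\}$ there exists a submorphism $\phi_a:\mathcal{P}_a\to \mathcal{A}$ such that (1) $\mathcal{P}_a$ is a subalgebra of $\mathcal{P}(\omega)$ that contains all finite sets; (2) $\phi_a(\{n\}) = a_n$ for every $n<\omega$; (3) for any infinite $\sigma\subset \omega$, and for any family of pairwise disjoint elements $\{b_n : n\in \sigma\}\subset \mathcal{A}\setminus\{0\}$ orthogonal with $\{a_n: n<\omega\}$, there exists $\tau\subset\sigma$ such that (a) $\tau\in\mathcal{P}_a$, and (b) $\{b_n : n\in \tau\}$ and $\{b_n : n\in\sigma\setminus\tau\}$ are not separated in $\mathcal{A}$. Then for every bounded linear operator $T:C(K)\to C(K)$ there exists a proper nonempty clopen subset $L$ of $K$ such that $\{f\in C(K) : f|_{K\setminus L} = 0\}$ is an invariant subspace of $T$.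
   Context: A topological space is called an almost $P$-space if every nonempty $G_\delta$-set (countable intersection of open sets) has nonempty interior. A Boolean algebra is an almost $P$-algebra if its Stone space is an almost $P$-space. A family $\{a_n\}$ in a Boolean algebra is pairwise disjoint if $a_n\wedge a_m=0$ for $n\neq m$. Two subsets $I,J$ of a Boolean algebra $\mathcal A$ are orthogonal if $x\wedge y=0$ for all $x\in I$, $y\in J$; they are separated in $\mathcal A$ if there exists $c\in\mathcal A$ such that $x\leq c$ and $y\wedge c=0$ for all $x\in I$, $y\in J$. A function $\phi:\mathcal A_1\to\mathcal A_2$ between Boolean algebras is a submorphism if $\phi(a\wedge b)=\phi(a)\wedge\phi(b)$, $\phi(a\vee b)=\phi(a)\vee\phi(b)$ and $\phi(0)=0$ (it is not required that $\phi(1)=1$). $\mathcal{P}(\omega)$ is the Boolean algebra of all subsets of $\omega$. $C(K)$ is the Banach space of real-valued continuous functions on $K$ with the supremum norm. A subspace $Y$ is invariant for $T$ if $T(Y)\subset Y$.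
   Formalization: The Boolean algebra is additionally assumed infinite; for every finite algebra the hypotheses hold vacuously but the conclusion fails (no proper nonempty clopen set if K has at most one point, otherwise take the cyclic shift of coordinates). *)

(* Defs.v *)
From HB Require Import structures.
From mathcomp Require Import all_boot all_order all_algebra.
From mathcomp Require Import all_classical all_reals all_analysis.
From mathcomp Require Import borel_hierarchy.

Set Implicit Arguments.
Unset Strict Implicit.
Unset Printing Implicit Defensive.

Import Order.TTheory GRing.Theory Num.Theory.
Import numFieldNormedType.Exports.

Local Open Scope classical_set_scope.
Local Open Scope ring_scope.

(* A Boolean algebra is a [ctbDistrLatticeType]; `&`, `|`, ~` written in scope %O
   are its lattice operations, those in classical_set_scope are the
   set-theoretic ones. *)

Section BooleanAlgebra.
Context {d : Order.disp_t} {A : ctbDistrLatticeType d}.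

Definition pairwise_disjoint (D : set nat) (a : nat -> A) :=
  forall i j, D i -> D j -> i <> j -> (a i `&` a j)%O = \bot%O.

Definition orthogonal_sets (I J : set A) :=
  forall x y, I x -> J y -> (x `&` y)%O = \bot%O.

Definition separated_sets (I J : set A) :=
  exists c : A, (forall x, I x -> (x <= c)%O) /\
                (forall y, J y -> (y `&` c)%O = \bot%O).

Definition is_subalgebra (P : set A) :=
  [/\ P \bot%O, P \top%O,
      forall x y, P x -> P y -> P (x `&` y)%O,
      forall x y, P x -> P y -> P (x `|` y)%O &
      forall x, P x -> P (~` x)%O].

(* Stone space: ultrafilters of A. *)
Definition is_ultrafilter (U : set A) :=
  [/\ U \top%O, ~ U \bot%O,
      forall x y, U x -> U y -> U (x `&` y)%O,
      forall x y, (x <= y)%O -> U x -> U y &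
      forall x, U x \/ U (~` x)%O].

End BooleanAlgebra.

(* A submorphism P -> A2, where P is a subalgebra of A1, is represented by a
   function on the whole of A1 whose values outside P are irrelevant. *)
Definition is_submorphism d1 d2 (A1 : ctbDistrLatticeType d1)
    (A2 : ctbDistrLatticeType d2) (P : set A1) (phi : A1 -> A2) :=
  [/\ forall x y, P x -> P y -> phi (x `&` y)%O = (phi x `&` phi y)%O,
      forall x y, P x -> P y -> phi (x `|` y)%O = (phi x `|` phi y)%O &
      phi \bot%O = \bot%O].

Record stone d (A : ctbDistrLatticeType d) :=
  Stone { stone_set : set A; stone_ultra : is_ultrafilter stone_set }.

Definition stone_basic d (A : ctbDistrLatticeType d) (a : A) : set (stone A) :=
  [set u | stone_set u a].

Section StoneTopology.
Context d (A : ctbDistrLatticeType d).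
Notation K := (stone A).

HB.instance Definition _ := gen_eqMixin K.
HB.instance Definition _ := gen_choiceMixin K.

Let basic_cover : \bigcup_(B in range (@stone_basic d A)) id B = setT.
Proof.
apply/seteqP; split => // u _; exists (stone_basic \top%O); first by exists \top%O.
by case: (stone_ultra u).
Qed.

Let basic_join (B C : set K) (u : K) :
  range (@stone_basic d A) B -> range (@stone_basic d A) C -> id B u -> id C u ->
  exists E, [/\ range (@stone_basic d A) E, id E u & id E `<=` id B `&` id C].
Proof.
move=> [a _ <-] [b _ <-] /= ua ub; exists (stone_basic (a `&` b)%O); split.
- by exists (a `&` b)%O.
- by case: (stone_ultra u) => _ _ + _ _; apply.
- move=> v; rewrite /stone_basic /= => vab.
  by case: (stone_ultra v) => _ _ _ up _; split; apply: up vab;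
    [exact: leIl|exact: leIr].
Qed.

HB.instance Definition _ := @isBaseTopological.Build K
  (set K) (range (@stone_basic d A)) id basic_cover basic_join.

Lemma stone_basic_open (a : A) : open (stone_basic a).
Proof.
exists [set stone_basic a]; first by move=> _ ->; exists a.
by rewrite bigcup_set1.
Qed.

Lemma nbhs_stoneP (u : K) (B : set K) :
  nbhs u B <-> exists2 a : A, stone_set u a & stone_basic a `<=` B.
Proof.
split => [|[a ua aB]]; last first.
  apply: (filterS aB); apply: open_nbhs_nbhs; split => //.
  exact: stone_basic_open.
rewrite nbhsE => -[V [[D' D'D <-] [S D'S Su]] VB].
have [a _ aS] := D'D _ D'S; subst S.
by exists a => // v va; apply: VB; exists (stone_basic a).
Qed.

Lemma stone_basicC (a : A) : stone_basic (~` a)%O = ~` stone_basic a.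
Proof.
apply/seteqP; split => u; rewrite /stone_basic /=; case: (stone_ultra u) => _ u0 uI _ uC.
  by move=> uNa ua; apply: u0; rewrite -(Order.CTBDistrLatticeTheory.meetxC a); exact: uI.
by case: (uC a).
Qed.

Lemma stone_compact : compact [set: K].
Proof.
rewrite compact_ultra => F UF _.
have pF : ProperFilter F by exact: ultra_proper.
pose U := [set a : A | F (stone_basic a)].
have Uu : is_ultrafilter U.
  split.
  - apply: filterS (filterT) => u _.
    by rewrite /stone_basic /=; case: (stone_ultra u).
  - rewrite /U /= => F0; apply: (@filter_not_empty _ F pF).
    by apply: filterS F0 => u; rewrite /stone_basic /=; case: (stone_ultra u).
  - move=> a b Fa Fb; apply: filterS (filterI Fa Fb) => u [].
    by rewrite /stone_basic /=; case: (stone_ultra u) => _ _ uI _ _; exact: uI.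
  - move=> a b ab; apply: filterS => u.
    by rewrite /stone_basic /=; case: (stone_ultra u) => _ _ _ up _; exact: up.
  - by move=> a; rewrite /U /= stone_basicC; exact: in_ultra_setVsetC.
exists (Stone Uu); split => // B /nbhs_stoneP[a Ua aB].
exact: filterS aB Ua.
Qed.

End StoneTopology.

Definition almost_P_space (X : topologicalType) :=
  forall G : set X, Gdelta G -> G !=set0 -> interior G !=set0.

Definition almost_P_algebra d (A : ctbDistrLatticeType d) :=
  almost_P_space (stone A).

(* C(K) for K compact. The proof of compactness is a parameter of the type
   because it is what makes the supremum norm finite. *)
Section ContinuousFunctions.
Context {R : realType} {K : topologicalType}.

Definition cts_pred : {pred K -> R} := mem [set f : K -> R | continuous f].

Let cts_submod : submod_closed cts_pred.
Proof.
split; first by rewrite inE /= => x; exact: cvg_cst.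
move=> c f g; rewrite !inE /= => cf cg x.
by apply: cvgD; [apply: cvgZr; exact: cf|exact: cg].
Qed.

HB.instance Definition _ := GRing.isSubmodClosed.Build R (K -> R) cts_pred
  cts_submod.

Record cfun (cK : compact [set: K]) :=
  CFun { cfun_fun :> K -> R; cfun_cts : cfun_fun \in cts_pred }.

Context (cK : compact [set: K]).

HB.instance Definition _ := [isSub for @cfun_fun cK].
HB.instance Definition _ := [Choice of cfun cK by <:].
HB.instance Definition _ := [SubChoice_isSubLmodule of cfun cK by <:].

Lemma cfun_continuous (f : cfun cK) : continuous f.
Proof. by have := cfun_cts f; rewrite inE. Qed.

Definition supnorm (f : cfun cK) : R := sup [set `|f x| | x in [set: K]].

Lemma supnorm_has_ubound (f : cfun cK) :
  has_ubound [set `|f x| | x in [set: K]].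
Proof.
have cf : compact (f @` [set: K]).
  by apply: continuous_compact cK; apply: continuous_subspaceT;
    exact: cfun_continuous.
have [M [_ /(_ (M + 1))]] := compact_bounded cf.
rewrite ltrDl ltr01 => /(_ isT) HM.
by exists (M + 1) => _ [x _ <-]; apply: HM; exists x.
Qed.

Lemma supnorm_ub (f : cfun cK) (x : K) : `|f x| <= supnorm f.
Proof. by apply: ub_le_sup; [exact: supnorm_has_ubound|exists x]. Qed.

Lemma supnorm_le (f : cfun cK) (M : R) :
  0 <= M -> (forall x, `|f x| <= M) -> supnorm f <= M.
Proof.
move=> M0 fM; rewrite /supnorm.
have [->|ne] := eqVneq [set `|f x| | x in [set: K]] set0; first by rewrite sup0.
by apply: ge_sup; [exact/set0P|move=> _ [x _ <-]].
Qed.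

Lemma supnorm_ge0 (f : cfun cK) : 0 <= supnorm f.
Proof.
have [K0|/set0P[x _]] := eqVneq [set: K] set0.
  by rewrite /supnorm K0 image_set0 sup0.
exact: le_trans (normr_ge0 (f x)) (supnorm_ub f x).
Qed.

Let supnormD (f g : cfun cK) : supnorm (f + g) <= supnorm f + supnorm g.
Proof.
apply: supnorm_le => [|x]; first by rewrite addr_ge0 ?supnorm_ge0.
by rewrite (le_trans (ler_normD _ _))// lerD ?supnorm_ub.
Qed.

Let supnormZ (c : R) (f : cfun cK) : supnorm (c *: f) = `|c| * supnorm f.
Proof.
have le1 (a : R) (g : cfun cK) : supnorm (a *: g) <= `|a| * supnorm g.
  apply: supnorm_le => [|x]; first by rewrite mulr_ge0 ?supnorm_ge0.
  by rewrite [leLHS]normrM ler_wpM2l ?supnorm_ub.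
apply/eqP; rewrite eq_le le1 /=.
have [->|c0] := eqVneq c 0; first by rewrite normr0 mul0r supnorm_ge0.
rewrite mulrC -ler_pdivlMr ?normr_gt0// mulrC -normfV.
by apply: le_trans (le1 _ _); rewrite scalerA mulVf// scale1r.
Qed.

Let supnorm0_eq0 (f : cfun cK) : supnorm f = 0 -> f = 0.
Proof.
move=> f0; apply/val_inj/funext => x /=; apply/eqP.
by rewrite -normr_le0 -f0 supnorm_ub.
Qed.

HB.instance Definition _ := @Lmodule_isNormed.Build R (cfun cK)
  supnorm supnormD supnormZ supnorm0_eq0.

Lemma cfun_normE (f : cfun cK) : `|f| = sup [set `|f x| | x in [set: K]].
Proof. by []. Qed.

End ContinuousFunctions.
Arguments cfun : clear implicits.

Notation stone_cfun R A := (cfun R (stone A) (@stone_compact _ A)).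

Definition bounded_operator {R : realType} {V : normedModType R}
    (T : {linear V -> V}) :=
  exists M : R, forall v : V, `|T v| <= M * `|v|.

Definition invariant_subspace {R : realType} {V : normedModType R}
    (T : {linear V -> V}) (Y : set V) :=
  submod_closed (mem Y) /\ T @` Y `<=` Y.

(* {f \in C(K) : f = 0 on K \ L} *)
Definition supported_in {R : realType} {K : topologicalType}
    {cK : compact [set: K]} (L : set K) : set (cfun R K cK) :=
  [set f | forall x, (~` L) x -> f x = 0].

(* The index set sigma of b is encoded by a total b : nat -> A of which only the
   values on sigma matter. *)
Definition good_submorphism d (A : ctbDistrLatticeType d) (a : nat -> A)
    (P : set (set nat)) (phi : set nat -> A) :=
  [/\ is_subalgebra P /\ (forall s : set nat, finite_set s -> P s),
      is_submorphism P phi,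
      forall n : nat, phi [set n] = a n &
      forall (sigma : set nat) (b : nat -> A),
        infinite_set sigma ->
        (forall n, sigma n -> b n <> \bot%O) ->
        pairwise_disjoint sigma b ->
        orthogonal_sets (b @` sigma) (range a) ->
        exists tau : set nat,
          [/\ tau `<=` sigma, P tau &
              ~ separated_sets (b @` tau) (b @` (sigma `\` tau))]].

(* Main.v *)
Require Import Defs.
From HB Require Import structures.
From mathcomp Require Import all_boot all_order all_algebra.
From mathcomp Require Import all_classical all_reals all_analysis.
From mathcomp Require Import lra.

Set Implicit Arguments.
Unset Strict Implicit.
Unset Printing Implicit Defensive.

Import Order.TTheory GRing.Theory Num.Theory.
Import Order.CTBDistrLatticeTheory.
Import numFieldNormedType.Exports.

Local Open Scope classical_set_scope.
Local Open Scope ring_scope.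

(** For y in the Stone space K, a |-> T(1_a)(y) is a finitely additive set
function mu_y whose variation is at most the norm of T, and which depends
continuously on y.  If no clopen set is as required, then, indicators having a
dense span, every element c other than 0 and 1 has some a below it with
mu_y(a) <> 0 at some y outside c (not_invariant_indicator).  Since K is an
infinite compact almost P-space, near a nonisolated point one finds disjoint a_n
and points x_n outside a_n with |mu_(x_n)(a_n)| > eps for one and the same eps
(diagonal_sequence).  Rosenthal's lemma makes the sum of the |mu_(x_n)(a_k)| over
k <> n as small as wanted, and almost P-ness spreads this from x_n to a clopen
set b_n, where the b_n are disjoint from each other and from all the a_k
(dominated_diagonal).

Let phi be the submorphism given for this sequence a.  If mu_y were countably
additive on the sets phi(t), the continuous function T(1_(phi t)) would be large
on b_n for n in t and small on b_n for the other n, so that a clopen set would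
separate the two groups, and the nonseparation hypothesis would be contradicted.
Countable additivity can fail because phi(t) may be larger than the union of the
a_k with k in t.  These excesses are however disjoint for almost disjoint t, as
phi maps finite sets to finite joins of the a_k.  Hence, at each point, at most
M / delta members of an almost disjoint family have an excess of mass more than
delta (heavy_family_size), M being a bound of T.  Replace each b_n by a smaller
clopen set on which as many t as possible are bad at all points, where the
allowed t are subsets of distinct members of an almost disjoint family of
cardinality continuum; here almost P-ness says that if t is bad at one point of b_n
then t is bad on a nonempty clopen part of b_n (heavy_clopen).  Only countably
many members of the family are involved in this, so there is one left over; the
nonseparation hypothesis applied within it gives a t, and by maximality t is not
bad at any point of any b_n (no_dominated_diagonal). *)

(** * Boolean algebras and their ultrafilters *)

Section Ultrafilters.
Context {d : Order.disp_t} {A : ctbDistrLatticeType d}.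
Implicit Types (a b c : A) (u : stone A).

Lemma stone_setT u : stone_set u \top%O.
Proof. by case: (stone_ultra u). Qed.

Lemma stone_set0 u : stone_set u \bot%O = False.
Proof. by apply/propext; split => //; case: (stone_ultra u). Qed.

Lemma stone_setI u a b :
  stone_set u (a `&` b)%O = (stone_set u a /\ stone_set u b).
Proof.
have [_ _ uI up _] := stone_ultra u.
apply/propext; split => [uab|[]]; last exact: uI.
by split; apply: up uab; [exact: leIl|exact: leIr].
Qed.

Lemma stone_setC u a : stone_set u (~` a)%O = ~ stone_set u a.
Proof. exact: (congr1 (fun B : set (stone A) => B u) (stone_basicC a)). Qed.

Lemma stone_setU u a b :
  stone_set u (a `|` b)%O = (stone_set u a \/ stone_set u b).
Proof.
rewrite -[(_ `|` _)%O]complK complU stone_setC stone_setI !stone_setC.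
by rewrite not_andE !notK.
Qed.

Lemma stone_set_le u a b : (a <= b)%O -> stone_set u a -> stone_set u b.
Proof. by case: (stone_ultra u) => _ _ _ up _; exact: up. Qed.

(** The Boolean prime ideal theorem, phrased as a compactness principle: a
property of elements that is inherited by smaller elements and by finite joins
and that holds near every point of the Stone space holds globally.  If it failed
at the top, a maximal filter among those closed under subtracting elements of
the ideal would be an ultrafilter missing the ideal. *)
Lemma stone_local_global (I : set A) :
    I \bot%O -> (forall a b, (a <= b)%O -> I b -> I a) ->
    (forall a b, I a -> I b -> I (a `|` b)%O) ->
    (forall u, exists2 c, stone_set u c & I c) ->
  I \top%O.
Proof.
move=> I0 Idown IU Iloc; apply: contrapT => nI1.
(* The empty set has to satisfy P, as it is the union of the empty chain. *)
pose P (X : set A) := [/\ forall x y, X x -> X y -> X (x `&` y)%O,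
  forall x y, (x <= y)%O -> X x -> X y, ~ X \bot%O &
  forall x c, X x -> I c -> X (x `&` ~` c)%O].
have [U [[UI Uup U0 UIC] Umax]] : exists U, P U /\ forall B, U `<` B -> ~ P B.
  apply: Zorn_bigcup => F FP Ftot; split.
  - move=> x y [X FX Xx] [Y FY Yy].
    have [XY|YX] := Ftot _ _ FX FY.
      by exists Y => //; case: (FP _ FY) => + _ _ _; apply => //; exact: XY.
    by exists X => //; case: (FP _ FX) => + _ _ _; apply => //; exact: YX.
  - move=> x y xy [X FX Xx]; exists X => //.
    by case: (FP _ FX) => _ + _ _; apply; eassumption.
  - by case=> X FX; case: (FP _ FX).
  - by move=> x c [X FX Xx] Ic; exists X => //; case: (FP _ FX) => _ _ _; apply.
have U1 : U \top%O.
  apply: contrapT => nU1.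
  have Uset0 x : ~ U x by move=> Ux; apply: nU1; apply: Uup Ux; exact: lex1.
  apply: (Umax [set x | I (~` x)%O]).
    split; first by move=> x /Uset0.
    by move/(_ \top%O) => /=; rewrite compl1 => /(_ I0)/Uset0.
  split => /=.
  - by move=> x y Ix Iy; rewrite complI; exact: IU.
  - by move=> x y xy; apply: Idown; rewrite leC.
  - by rewrite compl0.
  - by move=> x c Ix Ic; rewrite complI complK; exact: IU.
have Uultra : is_ultrafilter U.
  split => // x; apply: contrapT => /not_orP[nUx nUCx].
  apply: (Umax [set z | exists2 w, U w & (w `&` x <= z)%O]).
    split; first by move=> z Uz; exists z => //; exact: leIl.
    by move/(_ x) => Ux; apply/nUx/Ux; exists \top%O => //; exact: leIr.
  split => /=.
  - move=> y z [w Uw wy] [w' Uw' wz]; exists (w `&` w')%O; first exact: UI.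
    rewrite lexI (le_trans _ wy) ?(le_trans _ wz) //; apply: leI2 => //.
      exact: leIr.
    exact: leIl.
  - by move=> y z yz [w Uw wy]; exists w => //; exact: le_trans yz.
  - case=> w Uw; rewrite lex0 disj_leC => wx.
    by apply: nUCx; exact: Uup Uw.
  - move=> y c [w Uw wy] Ic; exists (w `&` ~` c)%O; first exact: UIC.
    by rewrite meetAC; exact: leI2.
have [c /= Uc Ic] := Iloc (Stone Uultra).
by apply: U0; rewrite -(meetxC c); exact: UIC.
Qed.

Lemma stone_point a : a <> \bot%O -> exists u, stone_set u a.
Proof.
move=> a0; apply: contrapT => /forallNP au; apply: a0.
suff: (\top `&` a)%O = \bot%O by rewrite meet1x.
apply: (@stone_local_global [set c | (c `&` a)%O = \bot%O]) => /=.
- exact: meet0x.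
- by move=> b c bc c0; apply/eqP; rewrite -lex0 -c0; exact: leI2.
- by move=> b c b0 c0; rewrite meetUl b0 c0 joinx0.
- by move=> u; exists (~` a)%O; [rewrite stone_setC; exact: au|exact: meetCx].
Qed.

Lemma stone_le a b : (forall u, stone_set u a -> stone_set u b) -> (a <= b)%O.
Proof.
move=> ab; rewrite -[b]complK -disj_leC; apply/eqP; apply: contrapT => /stone_point[u].
by rewrite stone_setI stone_setC => -[/ab].
Qed.

Lemma stone_eq a b : (forall u, stone_set u a = stone_set u b) -> a = b.
Proof.
by move=> ab; apply/le_anti/andP; split; apply: stone_le => u; rewrite ab.
Qed.

Lemma stone_eq0 a : (forall u, ~ stone_set u a) -> a = \bot%O.
Proof.
by move=> a0; apply: stone_eq => u; rewrite stone_set0; apply/propext; split => // /a0.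
Qed.

Lemma disjoint_stone u a b :
  (a `&` b)%O = \bot%O -> stone_set u a -> stone_set u b -> False.
Proof. by move=> ab ua ub; rewrite -(stone_set0 u) -ab stone_setI. Qed.

(** Were every point isolated, compactness would split the space into finitely
many clopen sets having finitely many clopen subsets each. *)
Lemma exists_nonisolated : infinite_set [set: A] ->
  exists p, forall c, stone_set p c ->
    exists c', [/\ (c' <= c)%O, c' <> \bot%O & ~ stone_set p c'].
Proof.
move=> Ainf; apply: contrapT => /forallNP isol; apply: Ainf.
pose I := [set c : A | finite_set [set x | (x <= c)%O]].
suff: I \top%O by apply: sub_finite_set => x _ /=; exact: lex1.
apply: stone_local_global => /=.
- by apply: (@sub_finite_set _ _ [set \bot%O]) => // x /=; rewrite lex0 => /eqP.
- by move=> a b ab; apply: sub_finite_set => x /= xa; exact: le_trans ab.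
- move=> a b Ia Ib.
  apply: sub_finite_set (finite_image2 Order.join Ia Ib).
  move=> x /= xab; exists (x `&` a)%O => /=; first exact: leIr.
  exists (x `&` b)%O => /=; first exact: leIr.
  by rewrite -meetUr; exact/meet_idPl.
- move=> p; have /existsNP[c /not_implyP[pc /forallNP nc]] := isol p.
  exists c => //; apply: (@sub_finite_set _ _ [set \bot%O; c]) => // x /= xc.
  have [->|x0] := pselect (x = \bot%O); [by left|right].
  apply/le_anti; rewrite xc /=; apply: contrapT => cx.
  have xN : ~ stone_set p x -> False by move=> px; apply: (nc x).
  apply: (nc (c `&` ~` x)%O); split; first exact: leIl.
    by move/eqP; rewrite disj_leC complK.
  by rewrite stone_setI stone_setC => -[].
Qed.

(** In an almost P-space a countable intersection of open sets containing a
point contains a whole nonempty clopen set, though not necessarily around that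
point. *)
Lemma almost_P_clopen (F : nat -> set (stone A)) u : almost_P_algebra A ->
    (forall n, open (F n)) -> (forall n, F n u) ->
  exists2 b, b <> \bot%O & forall v, stone_set v b -> forall n, F n v.
Proof.
move=> AP Fo Fu.
have [||v] := AP (\bigcap_n F n); first by exists F.
  by exists u => n _; exact: Fu.
move/nbhs_stoneP => [b vb bF]; exists b => [b0|w wb n].
  by rewrite b0 stone_set0 in vb.
exact: bF.
Qed.

End Ultrafilters.

(** * Continuous functions on the Stone space *)

Section StoneFunctions.
Context {R : realType} {d : Order.disp_t} {A : ctbDistrLatticeType d}.
Local Notation C := (stone_cfun R A).
Implicit Types (a b c : A) (u : stone A) (f g : C).

Lemma cfun_near f u (e : R) : 0 < e ->
  exists2 c, stone_set u c & forall v, stone_set v c -> `|f u - f v| < e.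
Proof.
move=> e0; have /cvgrPdist_lt/(_ e e0)/nbhs_stoneP[c uc cf] := @cfun_continuous _ _ _ f u.
by exists c.
Qed.

Lemma cutoff_cts f a :
  (fun u => if `[< stone_set u a >] then f u else 0) \in cts_pred.
Proof.
rewrite inE => u; apply/(@cvgrPdist_lt _ _ _ _ (nbhs_filter u)) => e e0.
have [c uc fc] := cfun_near f u e0; apply/nbhs_stoneP.
have [ua|ua] := pselect (stone_set u a).
  exists (a `&` c)%O; first by rewrite stone_setI.
  move=> v; rewrite /stone_basic /= stone_setI => -[va vc].
  by rewrite !asboolT //; exact: fc.
exists (~` a)%O => [|v]; first by rewrite stone_setC.
by rewrite /stone_basic /= stone_setC => va; rewrite !asboolF // subr0 normr0.
Qed.

Definition cutoff f a : C := CFun _ (cutoff_cts f a).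

Lemma cst_cts (r : R) : (fun _ : stone A => r) \in cts_pred.
Proof. by rewrite inE => u; exact: cst_continuous. Qed.

Definition cst_cfun (r : R) : C := CFun _ (cst_cts r).

Definition indicator a : C := cutoff (cst_cfun 1) a.

Lemma cutoffT f a u : stone_set u a -> cutoff f a u = f u.
Proof. by move=> ua; rewrite /cutoff /= asboolT. Qed.

Lemma cutoffF f a u : ~ stone_set u a -> cutoff f a u = 0.
Proof. by move=> ua; rewrite /cutoff /= asboolF. Qed.

Lemma indicatorT a u : stone_set u a -> indicator a u = 1.
Proof. exact: cutoffT. Qed.

Lemma indicatorF a u : ~ stone_set u a -> indicator a u = 0.
Proof. exact: cutoffF. Qed.

Lemma indicator_ge0 a u : 0 <= indicator a u.
Proof. by rewrite /indicator /=; case: ifP. Qed.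

Lemma cfun_ext f g : (forall u, f u = g u) -> f = g.
Proof. by move=> fg; apply/val_inj/funext. Qed.

Lemma cfun_sumE (I : Type) (s : seq I) (Q : pred I) (F : I -> C) u :
  (\sum_(i <- s | Q i) F i) u = \sum_(i <- s | Q i) F i u.
Proof.
elim: s => [|i s IH]; rewrite ?big_nil // !big_cons.
by case: ifP => // _; rewrite -IH.
Qed.

Lemma cfun_norm_le f (M : R) : 0 <= M -> (forall u, `|f u| <= M) -> `|f| <= M.
Proof. exact: supnorm_le. Qed.

Lemma cfun_norm_ub f u : `|f u| <= `|f|.
Proof. exact: supnorm_ub. Qed.

Lemma open_cfun_lt f (r : R) : open [set u | f u < r].
Proof.
rewrite openE => u /= fu; have [|c uc fc] := @cfun_near f u (r - f u).
  by rewrite subr_gt0.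
apply/nbhs_stoneP; exists c => // v /fc; rewrite /= ltr_distlC => /andP[_].
by rewrite addrC subrK.
Qed.

Lemma open_norm_cfun_gt f (r : R) : open [set u | r < `|f u|].
Proof.
rewrite openE => u /= fu; have [|c uc fc] := @cfun_near f u (`|f u| - r).
  by rewrite subr_gt0.
apply/nbhs_stoneP; exists c => // v /fc /(le_lt_trans (lerB_dist _ _)).
by rewrite ltrD2l ltrN2.
Qed.

Lemma indicatorU a b : (a `&` b)%O = \bot%O ->
  indicator (a `|` b)%O = indicator a + indicator b.
Proof.
move=> ab; apply: cfun_ext => u.
rewrite [RHS](_ : _ = indicator a u + indicator b u) //.
have [ua|ua] := pselect (stone_set u a).
  rewrite indicatorT; last by rewrite stone_setU; left.
  by rewrite indicatorT // indicatorF ?addr0 // => /(disjoint_stone ab ua).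
have [ub|ub] := pselect (stone_set u b).
  rewrite indicatorT; last by rewrite stone_setU; right.
  by rewrite indicatorF // indicatorT // add0r.
by rewrite !indicatorF ?addr0// stone_setU => -[].
Qed.

Lemma indicator0 : indicator \bot%O = 0.
Proof.
by apply: cfun_ext => u; rewrite indicatorF // stone_set0.
Qed.

Lemma sum_indicator_le1 (I : eqType) (s : seq I) (c : I -> A) u : uniq s ->
    (forall i j, i \in s -> j \in s -> i <> j -> (c i `&` c j)%O = \bot%O) ->
  \sum_(i <- s) indicator (c i) u <= 1.
Proof.
move=> us cs; have [[i si ui]|nu] := pselect (exists2 i, i \in s & stone_set u (c i)).
  rewrite (bigD1_seq i) // indicatorT // big_seq_cond big1 ?Monoid.mulm1 //.
  move=> j /andP[sj ji]; rewrite indicatorF // => uj.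
  apply: (disjoint_stone _ ui uj); apply: cs => // ij.
  by rewrite ij eqxx in ji.
rewrite big_seq big1 // => j sj; rewrite indicatorF // => uj; apply: nu.
by exists j.
Qed.

(** The set function a |-> T(1_a)(y) is finitely additive, and its variation
is bounded by the norm of T: test T on the combination of the indicators whose
coefficients are the signs of the values at y. *)
Lemma operator_variation_le (T : {linear C -> C}) (M : R) (I : eqType) (s : seq I)
    (c : I -> A) y :
    (forall f, `|T f| <= M * `|f|) -> 0 <= M -> uniq s ->
    (forall i j, i \in s -> j \in s -> i <> j -> (c i `&` c j)%O = \bot%O) ->
  \sum_(i <- s) `|T (indicator (c i)) y| <= M.
Proof.
move=> TM M0 us cs.
pose f : C := \sum_(i <- s) Num.sg (T (indicator (c i)) y) *: indicator (c i).
have f1 : `|f| <= 1.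
  apply: cfun_norm_le => // u; rewrite cfun_sumE.
  apply: le_trans (sum_indicator_le1 u us cs).
  apply: le_trans (ler_norm_sum _ _ _) _; apply: ler_sum => i _.
  rewrite [X in `|X|](_ : _ = Num.sg (T (indicator (c i)) y) * indicator (c i) u) //.
  rewrite normrM [X in _ * X]ger0_norm ?indicator_ge0 //.
  by rewrite ler_piMl ?indicator_ge0 // normr_sg lern1; case: eqP.
have -> : \sum_(i <- s) `|T (indicator (c i)) y| = T f y.
  rewrite linear_sum cfun_sumE; apply: eq_bigr => i _.
  by rewrite linearZ /= normrEsg.
apply: le_trans (ler_norm _) _; apply: le_trans (cfun_norm_ub _ _) _.
by apply: le_trans (TM _) _; rewrite ler_piMr.
Qed.

(** Linear combinations of indicators are dense, so a bounded operator can
only fail to preserve the functions supported in a clopen set if it already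
does so on an indicator. *)
Lemma not_invariant_indicator (T : {linear C -> C}) (M : R) a :
    (forall f, `|T f| <= M * `|f|) -> 0 <= M ->
    ~ invariant_subspace T (supported_in (stone_basic a)) ->
  exists c u, [/\ (c <= a)%O, ~ stone_set u a & T (indicator c) u != 0].
Proof.
move=> TM M0 ninv; apply: contrapT => Tind; apply: ninv.
have Tind0 c u : (c <= a)%O -> ~ stone_set u a -> T (indicator c) u = 0.
  move=> ca ua; apply/eqP/negPn/negP => Tcu; apply: Tind.
  by exists c, u.
split.
  split; first by rewrite inE.
  move=> r f g; rewrite !inE => fa ga u ua.
  by rewrite [LHS](_ : _ = r * f u + g u) // fa // ga // mulr0 addr0.
move=> _ [f fa <-] u ua.
have approx (e : R) : 0 < e -> exists2 g : C,
    T g u = 0 & forall v, `|f v - g v| <= e.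
  move=> e0.
  pose I := [set c | exists2 g : C, (forall b, T (cutoff g b) u = 0) &
    forall v, stone_set v c -> `|f v - g v| <= e].
  suff [g Tg fg] : I \top%O.
    exists (cutoff g \top%O) => // v.
    by rewrite cutoffT; [apply: fg|]; exact: stone_setT.
  apply: stone_local_global => /=.
  - exists 0 => [b|v]; last by rewrite stone_set0.
    rewrite (_ : cutoff 0 b = 0) ?linear0 //.
    by apply: cfun_ext => v; rewrite /cutoff /=; case: ifP.
  - move=> b c bc [g Tg fg]; exists g => // v vb; apply: fg.
    exact: stone_set_le vb.
  - move=> b c [g Tg fg] [h Th fh].
    exists (cutoff g b + cutoff h (~` b)%O).
      move=> x; rewrite (_ : cutoff _ x = cutoff g (b `&` x)%O + cutoff h (~` b `&` x)%O).
        by rewrite linearD; move: (Tg (b `&` x)%O) (Th (~` b `&` x)%O) => Tg0 Th0;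
          rewrite [LHS](congr2 +%R Tg0 Th0) addr0.
      apply: cfun_ext => v.
      rewrite [RHS](_ : _ = cutoff g (b `&` x)%O v + cutoff h (~` b `&` x)%O v) //.
      have [vx|vx] := pselect (stone_set v x); last first.
        by rewrite !cutoffF ?addr0 // stone_setI => -[].
      rewrite cutoffT //.
      rewrite [LHS](_ : _ = cutoff g b v + cutoff h (~` b)%O v) //.
      by rewrite /cutoff /= !stone_setI; congr (_ + _);
        congr (if _ then _ else _); apply/asbool_equiv_eq; split => [|[]].
    move=> v; rewrite stone_setU.
    rewrite [X in `|_ - X|](_ : _ = cutoff g b v + cutoff h (~` b)%O v) //.
    have [vb _|vb [//|vc]] := pselect (stone_set v b).
      by rewrite cutoffT // cutoffF ?addr0; [exact: fg|rewrite stone_setC].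
    by rewrite cutoffF // cutoffT ?add0r; [exact: fh|rewrite stone_setC].
  - move=> w; have [c wc cf] := cfun_near f w e0.
    exists c => //; exists (f w *: indicator a) => [b|v vc].
      rewrite (_ : cutoff _ b = f w *: indicator (a `&` b)%O).
        rewrite linearZ; move: (Tind0 (a `&` b)%O u (leIl _ _) ua) => T0.
        by rewrite [LHS](congr1 ( *%R (f w)) T0) mulr0.
      apply: cfun_ext => v.
      rewrite [RHS](_ : _ = f w * indicator (a `&` b)%O v) //.
      have [vb|vb] := pselect (stone_set v b).
        rewrite cutoffT // [LHS](_ : _ = f w * indicator a v) //; congr (_ * _).
        rewrite /indicator /cutoff /= stone_setI; congr (if _ then _ else _).
        by apply/asbool_equiv_eq; split => [|[]].
      by rewrite cutoffF // indicatorF ?mulr0 // stone_setI => -[].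
    rewrite [X in `|_ - X|](_ : _ = f w * indicator a v) //.
    have [va|va] := pselect (stone_set v a).
      by rewrite indicatorT // mulr1 distrC; exact/ltW/cf.
    by rewrite indicatorF // mulr0 fa // subr0 normr0 ltW.
apply/eqP; rewrite -normr_le0; apply/ler_addgt0Pr => e e0; rewrite add0r.
have M1 : 0 < M + 1 by rewrite ltr_wpDl.
have [g Tg fg] := approx (e / (M + 1)) (divr_gt0 e0 M1).
have -> : T f u = T (f - g) u.
  by rewrite linearB [RHS](_ : _ = T f u - T g u) // Tg subr0.
apply: le_trans (cfun_norm_ub _ _) _; apply: le_trans (TM _) _.
have fge : `|f - g| <= e / (M + 1) by apply: cfun_norm_le => //; rewrite divr_ge0 // ltW.
apply: le_trans (ler_wpM2l M0 fge) _.
by rewrite mulrCA ler_piMr ?ltW // ltr_pdivrMr // mul1r ltrDl.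
Qed.

(** Disjoint closed sets in the compact zero-dimensional Stone space are
separated by a clopen set; here they are a superlevel and a sublevel set. *)
Lemma clopen_between f (r s : R) : r < s ->
  exists c, forall u, (s <= `|f u| -> stone_set u c) /\
    (`|f u| <= r -> ~ stone_set u c).
Proof.
move=> rs; pose good c u := (s <= `|f u| -> stone_set u c) /\
    (`|f u| <= r -> ~ stone_set u c).
pose I := [set b | exists c, forall u, stone_set u b -> good c u].
suff [c cgood] : I \top%O by exists c => u; apply: cgood; exact: stone_setT.
apply: stone_local_global => /=.
- by exists \top%O => u; rewrite stone_set0.
- by move=> a b ab [c cgood]; exists c => u /(stone_set_le ab)/cgood.
- move=> a b [c cgood] [e egood].
  exists ((a `&` c) `|` (~` a `&` e))%O => u; rewrite stone_setU /good.
  rewrite stone_setU !stone_setI stone_setC.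
  have [ua _|ua [//|ub]] := pselect (stone_set u a).
    by have [c1 c2] := cgood _ ua; split => [/c1|/c2 ?]; [left|case=> -[]].
  by have [e1 e2] := egood _ ub; split => [/e1|/e2 ?]; [right|case=> -[]].
- move=> u; have [|c uc cf] := @cfun_near f u ((s - r) / 2).
    by rewrite divr_gt0 ?subr_gt0.
  exists c => //.
  have near v : stone_set v c ->
      `|f u| - `|f v| < (s - r) / 2 /\ `|f v| - `|f u| < (s - r) / 2.
    move=> /cf fv; split; apply: le_lt_trans (lerB_dist _ _) _ => //.
    by rewrite distrC.
  have [fu|fu] := leP `|f u| ((r + s) / 2).
    exists \bot%O => v /near[_ fv]; rewrite /good stone_set0.
    by split => // sv; lra.
  exists \top%O => v /near[fv _]; split => [_|vr _]; first exact: stone_setT.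
  by lra.
Qed.

End StoneFunctions.

(** * Combinatorics on the natural numbers *)

(** Split the indices into infinitely many infinite classes.  Either the rows of
some class have small sums within that class, or each class has a row with mass
at least delta spread over its own class; as such a row meets the set of all the
chosen rows only in itself, restricting to the chosen rows lowers the bound on
the row sums by delta. *)
Lemma rosenthal_step (R : realType) (delta : R) (N : nat) (m : nat -> nat -> R) :
    0 < delta -> (forall n k, 0 <= m n k) ->
    (forall n s, uniq s -> n \notin s -> \sum_(k <- s) m n k <= N%:R * delta) ->
  exists2 e : nat -> nat, injective e &
    forall n s, uniq s -> n \notin s -> \sum_(k <- s) m (e n) (e k) < delta.
Proof.
move=> delta0; elim: N m => [|N IH] m m0 mN.
  exists id => // n s us ns; apply: le_lt_trans (mN n s us ns) _.
  by rewrite mul0r.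
pose cls (p i : nat) : nat := pickle (p, i).
have cls_inj p i q j : cls p i = cls q j -> p = q /\ i = j.
  by move/(pcan_inj pickleK) => -[].
have [[p small]|large] := pselect (exists p, forall n s, uniq s -> n \notin s ->
    \sum_(k <- s) m (cls p n) (cls p k) < delta).
  by exists (cls p) => // i j /cls_inj[].
have /choice[g gP] : forall p, exists ns : nat * seq nat, [/\ uniq ns.2,
    ns.1 \notin ns.2 & delta <= \sum_(k <- ns.2) m (cls p ns.1) (cls p k)].
  move=> p; apply: contrapT => /forallNP np; apply: large; exists p.
  move=> n s us ns; rewrite ltNge; apply/negP => ds; apply: (np (n, s)).
  by split.
pose f p := cls p (g p).1.
have f_inj : injective f by move=> p q /cls_inj[].
have [||e e_inj eP] := IH (fun p q => m (f p) (f q)); first by move=> *; exact: m0.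
  move=> p s us ps; have [ug ng dg] := gP p.
  rewrite -(lerD2r delta) -[X in _ <= _ + X]mul1r -mulrDl natr1.
  apply: le_trans (lerD (lexx _) dg) _.
  have := mN (f p) ([seq f q | q <- s] ++ [seq cls p k | k <- (g p).2]).
  rewrite big_cat !big_map /=; apply; last first.
    rewrite mem_cat negb_or (mem_map f_inj) ps /=.
    by apply/negP => /mapP[k kg] /cls_inj[_ gk]; rewrite gk kg in ng.
  rewrite cat_uniq (map_inj_uniq f_inj) us /=.
  rewrite map_inj_uniq ?ug ?andbT //; last by move=> i j /cls_inj[].
  apply/hasPn => _ /mapP[k kg ->]; apply/negP => /mapP[q qs] /cls_inj[pq _].
  by rewrite pq qs in ps.
by exists (f \o e) => // i j /f_inj/e_inj.
Qed.

(** Rosenthal's lemma on disjointifying a bounded sequence of measures. *)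
Lemma rosenthal (R : realType) (delta M : R) (m : nat -> nat -> R) :
    0 < delta -> (forall n k, 0 <= m n k) ->
    (forall n s, uniq s -> n \notin s -> \sum_(k <- s) m n k <= M) ->
  exists2 e : nat -> nat, injective e &
    forall n s, uniq s -> n \notin s -> \sum_(k <- s) m (e n) (e k) < delta.
Proof.
move=> delta0 m0 mM; apply: (@rosenthal_step R delta (Num.bound (M / delta))) => //.
move=> n s us ns; apply: le_trans (mM n s us ns) _.
have M0 : 0 <= M by apply: le_trans (mM n [::] _ _); rewrite ?big_nil.
rewrite -ler_pdivrMr //; apply/ltW/archi_boundP.
by rewrite divr_ge0 // ltW.
Qed.

(** The codes of the finite initial segments of a 0-1 sequence: distinct
sequences give almost disjoint sets, so this is an almost disjoint family
indexed by the Cantor set. *)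
Definition branch (x : nat -> bool) : set nat :=
  range (fun n => pickle (mkseq x n)).

Lemma infinite_branch x : infinite_set (branch x).
Proof.
move=> /(finite_image (fun k => size (odflt [::] (unpickle k : option (seq bool))))).
move=> fin; apply: infinite_nat; apply: sub_finite_set fin => n _.
by exists (pickle (mkseq x n)); [exists n|rewrite pickleK /= size_mkseq].
Qed.

Lemma branch_almost_disjoint x y : x <> y ->
  exists K, forall n, branch x n -> branch y n -> (n < K)%N.
Proof.
move=> xy; have /existsNP[i xyi] : ~ forall i, x i = y i.
  by move=> e; apply/xy/funext.
exists (\max_(n < i.+1) pickle (mkseq x n)).+1 => _ [n _ <-] [n' _].
move=> /(pcan_inj pickleK) nn'; have en : n' = n.
  by rewrite -(size_mkseq y n') nn' size_mkseq.
rewrite {}en in nn'; have ni : (n < i.+1)%N.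
  rewrite ltnS leqNgt; apply/negP => ni; apply: xyi.
  by rewrite -(nth_mkseq false x ni) -nn' nth_mkseq.
by rewrite ltnS (leq_bigmax (Ordinal ni)).
Qed.

Lemma cantor_diagonal (F : nat -> seq (nat -> bool)) :
  exists x, forall n, x \notin F n.
Proof.
pose x k := if unpickle k : option (nat * nat) is Some (n, i)
  then ~~ nth xpred0 (F n) i k else true.
exists x => n; apply/negP => xF.
have xE : x (pickle (n, index x (F n))) =
    ~~ nth xpred0 (F n) (index x (F n)) (pickle (n, index x (F n))).
  by rewrite [LHS]/x pickleK.
by move: xE; rewrite nth_index //; case: (x _).
Qed.

(** * Failures of countable additivity *)

Definition tail (t : set nat) (K : nat) : set nat := t `&` [set k | (K <= k)%N].

Section Tails.
Context {R : realType} {d : Order.disp_t} {A : ctbDistrLatticeType d}.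
Local Notation C := (stone_cfun R A).
Context (T : {linear C -> C}) (M : R).
Context (T_bound : forall f, `|T f| <= M * `|f|) (M_ge0 : 0 <= M).
Context (a : nat -> A) (P : set (set nat)) (phi : set nat -> A).
Context (good : good_submorphism a P phi).
Implicit Types (b : A) (t : set nat) (y : stone A) (K : nat).

Lemma good_tail t K : P t -> P (tail t K).
Proof.
have [[[_ _ PI _ PC] Pfin] _ _ _] := good.
move=> Pt; rewrite /tail -meetEset; apply: PI => //.
rewrite (_ : [set k | (K <= k)%N] = (~` `I_K)%O).
  by apply/PC/Pfin/finite_II.
rewrite complEset; apply/seteqP; split => k /=; first by rewrite leqNgt => /negP.
by move/negP; rewrite -leqNgt.
Qed.

Lemma good_disjoint s t : P s -> P t -> s `&` t = set0 ->
  (phi s `&` phi t)%O = \bot%O.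
Proof.
have [_ [phiI _ phi0] _ _] := good.
by move=> Ps Pt st; rewrite -phiI // meetEset st -botEset.
Qed.

Lemma mass_tail t K y : P t ->
  T (indicator (phi t)) y =
  \sum_(k < K | `[< t k >]) T (indicator (a k)) y
  + T (indicator (phi (tail t K))) y.
Proof.
have [[_ Pfin] [phiI phiU phi0] phi1 _] := good.
move=> Pt; elim: K => [|K ->].
  rewrite big_ord0 add0r (_ : tail t 0 = t) //.
  by apply/seteqP; split => k; [case|].
have tailS : t K -> T (indicator (phi (tail t K))) y =
    T (indicator (a K)) y + T (indicator (phi (tail t K.+1))) y.
  move=> tK; rewrite (_ : tail t K = [set K] `|` tail t K.+1).
    have P1 : P [set K] by exact: Pfin.
    have PS := good_tail K.+1 Pt.
    rewrite -joinEset phiU // phi1 indicatorU ?linearD //.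
    rewrite -phi1; apply: good_disjoint => //.
    by apply/seteqP; split => // k [->] [_] /=; rewrite ltnn.
  apply/seteqP; split => k /=.
    by case=> tk; rewrite /= leq_eqVlt => /orP[/eqP ->|]; [left|right].
  by case=> [->|[tk /ltnW Kk]]; split => //=.
rewrite big_mkcond [in RHS]big_mkcond big_ord_recr /= -addrA; congr (_ + _).
have [tK|tK] := asboolP (t K); first by rewrite tailS.
rewrite add0r; congr (T (indicator (phi _)) y); apply/seteqP; split => k [tk /=].
  rewrite leq_eqVlt => /orP[/eqP kK|Kk]; [by rewrite -kK in tk|by split].
by move=> /ltnW; split.
Qed.

(** Countable additivity of a |-> T(1_a)(y) fails along t by more than delta:
the tails of phi t keep a mass that is not accounted for by the a k. *)
Definition heavy (delta : R) t y :=
  exists K0, forall K, (K0 <= K)%N ->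
    delta < `|T (indicator (phi (tail t K))) y|.

(** Each set is tagged with a branch containing it, and the tags are distinct;
hence the sets are almost disjoint, and a subset of an unused branch can be
added. *)
Definition heavy_family (delta : R) b (F : seq ((nat -> bool) * set nat)) :=
  [/\ uniq F, {in F &, injective fst},
      forall p, p \in F -> P p.2 /\ p.2 `<=` branch p.1 &
      forall y, stone_set y b -> forall p, p \in F -> heavy delta p.2 y].

Lemma eventually_all (I : eqType) (s : seq I) (Q : I -> nat -> Prop) :
    (forall i, i \in s -> exists K0, forall K, (K0 <= K)%N -> Q i K) ->
  exists K0, forall K, (K0 <= K)%N -> forall i, i \in s -> Q i K.
Proof.
elim: s => [|i s IH] Qs; first by exists 0%N.
have [K1 QK1] := Qs i (mem_head _ _).
have [|K2 QK2] := IH; first by move=> j js; apply: Qs; rewrite inE js orbT.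
exists (maxn K1 K2) => K; rewrite geq_max => /andP[K1K K2K] j.
by rewrite inE => /predU1P[->|]; [exact: QK1|exact: QK2].
Qed.

(** At a point y of b the tails of the members of a heavy family are eventually
disjoint, so that each of them takes a share delta of the variation at y. *)
Lemma heavy_family_size delta b F : b <> \bot%O -> heavy_family delta b F ->
  (size F)%:R * delta <= M.
Proof.
move=> /stone_point[y yb] [uF Finj FP Fheavy].
have [K1 Kheavy] := eventually_all (Fheavy y yb).
have [K2 Kdisj] : exists K0, forall K, (K0 <= K)%N -> forall p, p \in F ->
    forall q, q \in F -> p <> q -> tail p.2 K `&` tail q.2 K = set0.
  apply: eventually_all => p pF; apply: eventually_all => q qF.
  have [pq|pq] := pselect (p.1 = q.1).
    by exists 0%N => K _ []; exact: Finj.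
  have [K0 K0P] := branch_almost_disjoint pq; exists K0 => K K0K _.
  apply/seteqP; split => // k [[pk /= Kk] [qk _]].
  have : (k < K0)%N by apply: K0P; [exact: (FP p pF).2|exact: (FP q qF).2].
  by rewrite ltnNge (leq_trans K0K Kk).
pose K := maxn K1 K2.
have := @operator_variation_le R d A T M _ F (fun p => phi (tail p.2 K)) y T_bound M_ge0 uF.
move=> /(_ _)/(le_trans _); apply; last first.
  move=> p q pF qF pq; apply: good_disjoint; [exact/good_tail/(FP p pF).1|
    exact/good_tail/(FP q qF).1|apply: Kdisj => //; exact: leq_maxr].
have -> : (size F)%:R * delta = \sum_(p <- F) delta.
  by rewrite big_const_seq count_predT iter_addr_0 mulr_natl.
rewrite big_seq [leRHS]big_seq; apply: ler_sum => p pF.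
by apply/ltW/(Kheavy K) => //; exact: leq_maxl.
Qed.

Lemma heavy_family_maximal delta b0 : 0 < delta -> b0 <> \bot%O ->
  exists bF : A * seq ((nat -> bool) * set nat),
    [/\ (bF.1 <= b0)%O, bF.1 <> \bot%O, heavy_family delta bF.1 bF.2 &
      forall b p, (b <= bF.1)%O -> b <> \bot%O ->
        ~ heavy_family delta b (p :: bF.2)].
Proof.
move=> delta0 b00; apply: contrapT => /forallNP nmax.
suff long n : exists bF : A * seq ((nat -> bool) * set nat),
    [/\ (bF.1 <= b0)%O, bF.1 <> \bot%O, heavy_family delta bF.1 bF.2 &
      size bF.2 = n].
  have [[b F] /= [_ bn0 /(heavy_family_size bn0) + sF]] := long (Num.bound (M / delta)).
  rewrite sF -ler_pdivlMr // leNgt => /negP; apply.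
  by apply: archi_boundP; rewrite divr_ge0 // ltW.
elim: n => [|n [[b F] /= [bb0 bn0 hF sF]]]; first by exists (b0, [::]).
apply: contrapT => /forallNP next; apply: (nmax (b, F)); split => //=.
move=> b' p b'b b'n0 hp; apply: (next (b', p :: F)); split => //=.
  exact: le_trans bb0.
by rewrite sF.
Qed.

(** Heaviness at y is witnessed by countably many open conditions on y, once the
index K0 is fixed, so almost P-ness applies. *)
Lemma heavy_clopen delta t b y : almost_P_algebra A -> stone_set y b ->
    heavy delta t y ->
  exists b', [/\ (b' <= b)%O, b' <> \bot%O &
    forall z, stone_set z b' -> heavy delta t z].
Proof.
move=> AP yb [K0 hy].
have [|n|b' b'n0 b'P] := @almost_P_clopen _ A (fun n => stone_basic b `&`
    [set z | delta < `|T (indicator (phi (tail t (K0 + n)))) z|]) y AP.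
- move=> n; apply: openI; first exact: stone_basic_open.
  exact: open_norm_cfun_gt.
- by split => //; apply/hy/leq_addr.
exists b'; split => // [|z zb']; first by apply: stone_le => z /b'P/(_ 0%N)[].
exists K0 => K K0K; have [_ /=] := b'P z zb' (K - K0)%N.
by rewrite subnKC.
Qed.

(** Take maximal heavy families on smaller b n, and a branch x that occurs in
none of them.  The set t obtained from the nonseparation property inside x is
then heavy nowhere on the b n, as it would extend a maximal family.  So at some
tail the value of T(1_(phi t)) on b n differs by at most 2 delta from the diagonal
term if n is in t, and from 0 otherwise; the function is at least 3 delta in the
first case and at most 2 delta in the second, and a clopen set in between
separates what should not be separated. *)
Lemma no_dominated_diagonal delta (b : nat -> A) : almost_P_algebra A ->
    0 < delta -> (forall n, b n <> \bot%O) ->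
    (forall i j, i <> j -> (b i `&` b j)%O = \bot%O) ->
    (forall n k, (b n `&` a k)%O = \bot%O) ->
    (forall n y, stone_set y (b n) -> 5 * delta < `|T (indicator (a n)) y|) ->
    (forall n y, stone_set y (b n) -> forall K,
      \sum_(k < K | k != n :> nat) `|T (indicator (a k)) y| < delta) ->
  False.
Proof.
move=> AP delta0 bn0 bdisj ba bdiag boff.
have [[_ Pfin] [_ _ _] _ nonsep] := good.
have /choice[bF bFP] n := heavy_family_maximal delta0 (bn0 n).
have [x xF] := cantor_diagonal (fun n => map fst (bF n).2).
pose b' n := (bF n).1.
have b'b n : (b' n <= b n)%O by have [] := bFP n.
have b'n0 n : b' n <> \bot%O by have [] := bFP n.
have [|||t [tx Pt]] := nonsep (branch x) b' (@infinite_branch x).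
- by move=> n _; exact: b'n0.
- move=> i j _ _ ij; apply: stone_eq0 => u; rewrite stone_setI => -[ui uj].
  exact: (disjoint_stone (bdisj _ _ ij) (stone_set_le (b'b i) ui) (stone_set_le (b'b j) uj)).
- move=> _ _ [n _ <-] [k _ <-]; apply: stone_eq0 => u; rewrite stone_setI.
  case=> un uk; exact: (disjoint_stone (ba n k) (stone_set_le (b'b n) un) uk).
apply.
have light n y : stone_set y (b' n) -> ~ heavy delta t y.
  move=> yb' hy; have [_ _ [uF Finj FP Fheavy] Fmax] := bFP n.
  have [b'' [b''b b''n0 b''P]] := heavy_clopen AP yb' hy.
  apply: (Fmax b'' (x, t) b''b b''n0); split.
  - rewrite /= uF andbT; apply/negP => xtF.
    by move/negP: (xF n); apply; apply/mapP; exists (x, t).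
  - have xnF p : p \in (bF n).2 -> x <> p.1.
      by move=> pF xp; move/negP: (xF n); apply; apply/mapP; exists p.
    move=> p q; rewrite !inE => /predU1P[->|pF] /predU1P[->|qF] //= pq.
    + by have := xnF q qF.
    + by have := xnF p pF; rewrite pq.
    + exact: Finj.
  - by move=> p; rewrite inE => /predU1P[->|/FP].
  - move=> z zb'' p; rewrite inE => /predU1P[->|pF]; first exact: b''P.
    by apply: Fheavy => //; exact: stone_set_le zb''.
have bounds n y : stone_set y (b' n) ->
    (t n -> 3 * delta <= `|T (indicator (phi t)) y|) /\
    (~ t n -> `|T (indicator (phi t)) y| <= 2 * delta).
  move=> yb'; have yb := stone_set_le (b'b n) yb'.
  have /forallNP/(_ n.+1)/existsNP[K /not_implyP[nK /negP]] := light n y yb'.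
  rewrite -leNgt => tailK; rewrite (mass_tail K y Pt).
  have offK := boff n y yb K.
  have diag := bdiag n y yb.
  pose off := \sum_(k < K | (k != n :> nat) && `[< t k >]) T (indicator (a k)) y.
  have off_lt : `|off| < delta.
    apply: le_lt_trans (ler_norm_sum _ _ _) _; apply: le_lt_trans offK.
    rewrite [leRHS]big_mkcond [leLHS]big_mkcond; apply: ler_sum => k _.
    by case: ifP => [/andP[->]|_] //; case: ifP.
  have [tn|tn] := pselect (t n); split => // _.
    rewrite (bigD1 (Ordinal nK)) /=; last exact/asboolP.
    rewrite (eq_bigl (fun k : 'I_K => (k != n :> nat) && `[< t k >])); last first.
      by move=> k; rewrite andbC -val_eqE.
    rewrite -/off -addrA.
    have := lerB_normD (T (indicator (a n)) y)
      (off + T (indicator (phi (tail t K))) y).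
    by have := ler_normD off (T (indicator (phi (tail t K))) y); lra.
  rewrite (eq_bigl (fun k : 'I_K => (k != n :> nat) && `[< t k >])); last first.
    move=> k; case: (eqVneq (k : nat) n) => //= ->; exact/asboolF.
  rewrite -/off.
  by have := ler_normD off (T (indicator (phi (tail t K))) y); lra.
have [c cP] := @clopen_between R d A (T (indicator (phi t))) (2 * delta) (3 * delta) ltac:(by lra).
exists c; split => [_ [n tn <-]|_ [n [xn tn] <-]].
  by apply: stone_le => u un; apply: (cP u).1; apply: (bounds n u un).1.
apply: stone_eq0 => u; rewrite stone_setI => -[un].
by apply: (cP u).2; apply: (bounds n u un).2.
Qed.
End Tails.

(** * Sequences concentrated on the diagonal *)

Section Diagonal.
Context {R : realType} {d : Order.disp_t} {A : ctbDistrLatticeType d}.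
Local Notation C := (stone_cfun R A).
Context (T : {linear C -> C}).

(** Fix a nonisolated point p.  If for each n some neighbourhood V n of p had no
suitable element for eps = 1 / (n + 1), then by almost P-ness a nonzero element
avoiding p would lie in all the V n, and T would move no indicator below it out
of its support.  So some eps works in every neighbourhood of p; as the elements
avoid p, they can be removed from the neighbourhood one after another. *)
Lemma diagonal_sequence :
    infinite_set [set: A] -> almost_P_algebra A ->
    (forall c, c <> \bot%O -> c <> \top%O -> exists a u,
       [/\ (a <= c)%O, ~ stone_set u a & T (indicator a) u != 0]) ->
  exists (eps : R) (a : nat -> A) (x : nat -> stone A), [/\ 0 < eps,
    forall i j, i <> j -> (a i `&` a j)%O = \bot%O,
    forall n, ~ stone_set (x n) (a n) &
    forall n, eps < `|T (indicator (a n)) (x n)|].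
Proof.
move=> Ainf AP Tind.
have [p p_noniso] := exists_nonisolated Ainf.
pose moved (eps : R) a u := ~ stone_set u a /\ eps < `|T (indicator a) u|.
have [[eps [eps0 far]]|near] := pselect (exists eps : R, 0 < eps /\
    forall U, stone_set p U -> exists au : A * stone A,
      [/\ (au.1 <= U)%O, ~ stone_set p au.1 & moved eps au.1 au.2]).
  pose nbr := {U : A | stone_set p U}.
  have /choice[f fP] : forall U : nbr, exists au : A * stone A,
      [/\ (au.1 <= sval U)%O, ~ stone_set p au.1 & moved eps au.1 au.2].
    by case=> U pU; exact: far.
  have step (U : nbr) : stone_set p (sval U `&` ~` (f U).1)%O.
    by rewrite stone_setI stone_setC; have [_ ? _] := fP U; split; [exact: svalP U|].
  pose U n := iter n (fun U => exist _ _ (step U) : nbr) (exist _ _ (stone_setT p)).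
  have U_anti n m : (n <= m)%N -> (sval (U m) <= sval (U n))%O.
    elim: m => [|m IH]; first by rewrite leqn0 => /eqP ->.
    rewrite leq_eqVlt => /predU1P[->//|/IH]; apply: le_trans => /=; exact: leIl.
  exists eps, (fun n => (f (U n)).1), (fun n => (f (U n)).2).
  have disj i j : (i < j)%N -> ((f (U i)).1 `&` (f (U j)).1)%O = \bot%O.
    move=> ij; apply: stone_eq0 => u; rewrite stone_setI => -[ui uj].
    have [ajU _ _] := fP (U j).
    have := stone_set_le (U_anti _ _ ij) (stone_set_le ajU uj).
    by rewrite /= stone_setI stone_setC => -[].
  split => // [i j ij|n|n]; last 2 first.
  - by have [_ _ []] := fP (U n).
  - by have [_ _ []] := fP (U n).
  have [/disj//|/disj|/ij//] := ltngtP i j.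
  by rewrite meetC.
exfalso; have /choice[V VP] : forall n, exists V, stone_set p V /\
    forall a u, (a <= V)%O -> ~ stone_set p a -> ~ moved n.+1%:R^-1 a u.
  move=> n; apply: contrapT => /forallNP nV; apply: near.
  exists n.+1%:R^-1; split => // V pV; apply: contrapT => /forallNP Va.
  by apply: (nV V); split => // a u aV pa mau; apply: (Va (a, u)).
have [|n|c cn0 cV] := @almost_P_clopen _ A (fun n => stone_basic (V n)) p AP.
- by move=> n; exact: stone_basic_open.
- by have [] := VP n.
have [c' [c'c c'n0 pc']] : exists c', [/\ (c' <= c)%O, c' <> \bot%O & ~ stone_set p c'].
  by have [/p_noniso//|pc] := pselect (stone_set p c); exists c.
have [|a [u [ac' ua Ta]]] := Tind c' c'n0.
  by move=> c'1; apply: pc'; rewrite c'1; exact: stone_setT.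
have [n] := ltr_add_invr (y := 0) (x := `|T (indicator a) u|) ltac:(by rewrite normr_gt0).
rewrite add0r => Tan; have [_ Vn] := VP n; apply: (Vn a u); last by split.
  by apply: stone_le => v /(stone_set_le ac')/(stone_set_le c'c)/cV/(_ n).
by move=> /(stone_set_le ac').
Qed.

Lemma norm_cfun_cts (f : C) : (fun u => `|f u|) \in cts_pred.
Proof.
rewrite inE => u; apply/(@cvgrPdist_lt _ _ _ _ (nbhs_filter u)) => e e0.
have [c uc fc] := cfun_near f u e0; apply/nbhs_stoneP; exists c => // v /fc.
exact/le_lt_trans/ler_dist_dist.
Qed.

Definition norm_cfun (f : C) : C := CFun _ (norm_cfun_cts f).

(** Rosenthal's lemma makes the measures at the points x n almost concentrated
on the corresponding a n, and the x n lie outside of all the a k.  All of this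
amounts to countably many open conditions, so it persists on clopen sets b n,
which are disjoint because the conditions for different n contradict each other. *)
Lemma dominated_diagonal (M eps : R) (a : nat -> A) (x : nat -> stone A) :
    almost_P_algebra A -> (forall f, `|T f| <= M * `|f|) -> 0 <= M -> 0 < eps ->
    (forall i j, i <> j -> (a i `&` a j)%O = \bot%O) ->
    (forall n, ~ stone_set (x n) (a n)) ->
    (forall n, eps < `|T (indicator (a n)) (x n)|) ->
  exists (delta : R) (e : nat -> nat) (b : nat -> A),
    [/\ 0 < delta, injective e,
        forall n, b n <> \bot%O,
        forall i j, i <> j -> (b i `&` b j)%O = \bot%O &
        forall n k, (b n `&` a (e k))%O = \bot%O] /\
    [/\ forall n y, stone_set y (b n) -> 5 * delta < `|T (indicator (a (e n))) y| &
        forall n y, stone_set y (b n) -> forall K,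
          \sum_(k < K | k != n :> nat) `|T (indicator (a (e k))) y| < delta].
Proof.
move=> AP TM M0 eps0 adisj xa Tax.
(* The second summand makes the same application of Rosenthal's lemma keep x n
   out of the a k with k <> n. *)
pose w k : C := norm_cfun (T (indicator (a k))) + indicator (a k).
have wE k u : w k u = `|T (indicator (a k)) u| + indicator (a k) u by [].
have w0 k u : 0 <= w k u by rewrite wE addr_ge0 ?indicator_ge0.
(* At most 1, so that the value 1 of a single indicator is already too large. *)
pose delta : R := Num.min (eps / 5) 1.
have delta0 : 0 < delta by rewrite lt_min divr_gt0 //=.
have delta5 : 5 * delta <= eps by rewrite mulrC -ler_pdivlMr // ge_min lexx.
have delta1 : delta <= 1 by rewrite ge_min lexx orbT.
have [||n s us _|e e_inj eP] := @rosenthal R delta (M + 1) (fun n k => w k (x n)) => //.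
  under eq_bigr do rewrite wE.
  rewrite big_split; apply: lerD.
    by apply: operator_variation_le => // i j _ _; exact: adisj.
  by apply: sum_indicator_le1 => // i j _ _; exact: adisj.
have near n : exists b, b <> \bot%O /\ forall y, stone_set y b ->
    [/\ 5 * delta < `|T (indicator (a (e n))) y|, ~ stone_set y (a (e n)) &
      forall K, \sum_(k < K | k != n :> nat) w (e k) y < delta].
  have [|K|b bn0 bP] := @almost_P_clopen _ A (fun K =>
    [set y | 5 * delta < `|T (indicator (a (e n))) y|] `&`
    stone_basic (~` a (e n))%O `&`
    [set y | (\sum_(k < K | k != n :> nat) w (e k)) y < delta]) (x (e n)) AP.
  - move=> K; apply: openI; last exact: open_cfun_lt.
    by apply: openI; [exact: open_norm_cfun_gt|exact: stone_basic_open].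
  - split; first split => /=.
    + by apply: le_lt_trans (Tax _).
    + by rewrite /stone_basic /= stone_setC.
    + rewrite /= -(big_mkord (fun k => k != n) (fun k => w (e k))) -big_filter cfun_sumE.
      apply: eP; last by rewrite mem_filter eqxx.
      by rewrite filter_uniq // iota_uniq.
  - exists b; split => // y yb; split.
    + by have [[]] := bP y yb 0%N.
    + by have [[_]] := bP y yb 0%N; rewrite /stone_basic /= stone_setC.
    + move=> K; have [_ /=] := bP y yb K.
      by rewrite cfun_sumE.
have /choice[b bP] := near.
have off n k y : n <> k -> stone_set y (b n) -> w (e k) y < delta.
  move=> nk yb; have [_ _ /(_ k.+1)] := (bP n).2 y yb; apply: le_lt_trans.
  rewrite (bigD1 ord_max) /=; last by apply/eqP => /esym.
  rewrite lerDl; apply: sumr_ge0 => i _; exact: w0.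
exists delta, e, b; split; split => //.
- by move=> n; exact: (bP n).1.
- move=> i j ij; apply: stone_eq0 => y; rewrite stone_setI => -[yi yj].
  have wj := off i j y ij yi; have [Tj _ _] := (bP j).2 y yj.
  have Tw : `|T (indicator (a (e j))) y| <= w (e j) y.
    by rewrite wE lerDl indicator_ge0.
  by have := lt_trans (lt_le_trans Tj Tw) wj; lra.
- move=> n k; apply: stone_eq0 => y; rewrite stone_setI => -[yn yk].
  have [nk|nk] := pselect (n = k).
    by have [_ + _] := (bP n).2 y yn; rewrite nk.
  have := off n k y nk yn; rewrite wE indicatorT //.
  by have := normr_ge0 (T (indicator (a (e k))) y); lra.
- by move=> n y yb; have [] := (bP n).2 y yb.
- move=> n y yb K; have [_ _ /(_ K)] := (bP n).2 y yb; apply: le_lt_trans.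
  by apply: ler_sum => k _; rewrite wE lerDl indicator_ge0.
Qed.

End Diagonal.

Theorem proposition5p1 (R : realType) (d : Order.disp_t)
    (A : ctbDistrLatticeType d)
    (A_infinite : infinite_set [set: A])
    (A_almost_P : almost_P_algebra A)
    (A_submorphisms : forall a : nat -> A,
       (forall n, a n <> \bot%O) -> pairwise_disjoint [set: nat] a ->
       exists (P : set (set nat)) (phi : set nat -> A),
         good_submorphism a P phi)
    (T : {linear stone_cfun R A -> stone_cfun R A})
    (T_bounded : bounded_operator T) :
  exists L : set (stone A),
    [/\ clopen L, L !=set0, L <> setT &
        invariant_subspace T (supported_in L)].
Proof.
apply: contrapT => /forallNP noninv.
have [M0 TM0] := T_bounded; pose M := Num.max M0 0.
have M_ge0 : 0 <= M by rewrite le_max lexx orbT.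
have TM f : `|T f| <= M * `|f|.
  by apply: le_trans (TM0 f) _; rewrite ler_wpM2r // le_max lexx.
have [|eps [a [x [eps0 adisj xa Tax]]]] := @diagonal_sequence R d A T A_infinite A_almost_P.
  move=> c cn0 cn1.
  have [|a [u [ac uc Ta]]] := @not_invariant_indicator R d A T M c TM M_ge0.
    move=> inv; apply: (noninv (stone_basic c)); split => //.
    - split; first exact: stone_basic_open.
      rewrite -[c]complK stone_basicC; apply: open_closedC; exact: stone_basic_open.
    - exact: stone_point.
    - move=> cT; apply: cn1; apply/eqP; rewrite -le1x; apply/stone_le => u _.
      by have : stone_basic c u by rewrite cT.
  by exists a, u; split => // /(stone_set_le ac).
have [delta [e [b [[delta0 e_inj bn0 bdisj ba] [bdiag boff]]]]] :=
  dominated_diagonal A_almost_P TM M_ge0 eps0 adisj xa Tax.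
have [|i j _ _ ij|P [phi good]] := A_submorphisms (a \o e).
- move=> n an0; have := Tax (e n); rewrite [a _]an0 indicator0 linear0.
  by rewrite [X in `|X|](_ : _ = 0) // normr0; lra.
- by apply: adisj => /e_inj/ij.
exact: (no_dominated_diagonal TM M_ge0 good A_almost_P delta0 bn0 bdisj ba bdiag boff).
Qed.
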